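(* There is a universal constant $C>0$ such that the following holds in the standing setting. For $\varepsilon>0$ let $N_\delta=\max\{k\in\mathbb{N}:\lambda_k>\delta\}$ and $$\delta^\ast=\min\Big\{\delta \;\Big|\; \delta>\nu(\Omega)\varepsilon^2,\ N_\delta\ge \frac{\lambda_1\exp\{-\frac{1}{4C}\mathcal{E}(\delta,\{\lambda_i\}_{i=1}^\infty)\}}{\big(\delta^{1/2}-\nu(\Omega)^{1/2}\varepsilon\big)^2}\Big\}.$$ Then $$\mathcal{H}^{\rm ext}\Big(\frac{\varepsilon}{2}, B_{\mathcal{H}_K}, C(\Omega)\Big)\ge \frac14\,\mathcal{E}(\delta^\ast,\{\lambda_i\}_{i=1}^\infty).$$
   Context: Standing setting: $\Omega\subseteq\mathbb{R}^n$ compact, $\nu$ a finite Borel measure on $\Omega$ (total mass $\nu(\Omega)$), $K:\Omega\times\Omega\to\mathbb{R}$ continuous, symmetric, positive semidefinite; $O_K[\phi](x)=\int_\Omega K(x,y)\phi(y)\,d\nu(y)$ on $L_2(\nu)$, with an orthonormal basis $\{\phi_i\}$ of $L_2(\nu)$ of continuous eigenfunctions, $O_K\phi_i=\lambda_i\phi_i$, $\lambda_1\ge\lambda_2\ge\dots>0$, and $K(x,y)=\sum_i\lambda_i\phi_i(x)\phi_i(y)$ uniformly. $\mathcal{H}_K$ is the RKHS of $K$, equal to $\{\sum a_i\phi_i:\sum a_i^2/\lambda_i<\infty\}$ with $\langle\sum a_i\phi_i,\sum b_i\phi_i\rangle_{\mathcal{H}_K}=\sum a_ib_i/\lambda_i$.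 $C(\Omega)$ carries the sup norm; $B_X$ is the open unit ball of $X$. $\mathcal{H}^{\rm ext}(\varepsilon,A,X)$ is the natural logarithm of the minimal number of balls $c+\varepsilon B_X$, $c\in X$, covering $A$. $\mathcal{E}(\varepsilon,\{\lambda_i\}_{i=1}^N)=\sum_{i\le N,\lambda_i>\varepsilon}\ln(\lambda_i/\varepsilon)$. *)

(* Defs.v *)
(* MathComp + MathComp-Analysis, specialised to Stdlib's concrete reals R
   (via Rstruct), so that the universal constant C is a single real number. *)
From HB Require Import structures.
From mathcomp Require Import all_boot all_order all_algebra.
From mathcomp Require Import all_classical all_reals all_analysis.
From mathcomp Require Import Rstruct Rstruct_topology.
Set Implicit Arguments. Unset Strict Implicit. Unset Printing Implicit Defensive.
Import Order.TTheory GRing.Theory Num.Theory.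
Import numFieldNormedType.Exports.
Local Open Scope classical_set_scope.
Local Open Scope ring_scope.

Notation R := Rdefinitions.R.

Definition Rn (n : nat) := 'rV[R]_n.
Notation BorelRn n := (g_sigma_algebraType (@open 'rV[R]_n)).

(* Eigenvalue sequence, indexed from 0 in Rocq: lam i is the paper's lambda_{i+1}. *)

(* N_delta = max { k >= 1 : lambda_k > delta } (paper indexing),
   with the convention N_delta = 0 when no eigenvalue exceeds delta.
   [Ndelta lam d k] says k is that maximum. *)
Definition Ndelta (lam : nat -> R) (d : R) (k : nat) : Prop :=
  (k = 0%N \/ ((0 < k)%N /\ d < lam k.-1)) /\
  (forall j : nat, (0 < j)%N -> d < lam j.-1 -> (j <= k)%N).

Definition Efin (eps : R) (lam : nat -> R) (N : nat) : R :=
  \sum_(i < N | eps < lam i) ln (lam i / eps).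

Definition Einf (eps : R) (lam : nat -> R) : R :=
  limn (series (fun i => if eps < lam i then ln (lam i / eps) else 0)).

Definition supnorm_on (n : nat) (Om : set 'rV[R]_n) (g : 'rV[R]_n -> R) : R :=
  sup [set `|g x| | x in Om].

(* Open unit ball of the RKHS H_K = { sum a_i phi_i : sum a_i^2/lambda_i < oo },
   ||sum a_i phi_i||^2 = sum a_i^2/lambda_i; its elements are viewed as
   (continuous) functions on Omega, the series sum a_i phi_i(x) converging at
   every x of Omega. *)
Definition RKHS_ball (n : nat) (Om : set 'rV[R]_n) (lam : nat -> R)
    (phi : nat -> 'rV[R]_n -> R) : set ('rV[R]_n -> R) :=
  [set f | exists a : nat -> R,
      cvgn (series (fun i => a i ^+ 2 / lam i)) /\
      limn (series (fun i => a i ^+ 2 / lam i)) < 1 /\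
      forall x, Om x -> series (fun i => a i * phi i x) @ \oo --> f x].

Definition covered_by (n : nat) (Om : set 'rV[R]_n) (eps : R)
    (A : set ('rV[R]_n -> R)) (N : nat) : Prop :=
  exists c : 'I_N -> 'rV[R]_n -> R,
    (forall j, {within Om, continuous (c j)}) /\
    forall f, A f -> exists j : 'I_N, supnorm_on Om (fun x => f x - c j x) < eps.

(* H^ext(eps, A, C(Omega)) = ln of the minimal number of such balls
   (+oo if no finite cover exists). *)
Definition Hext (n : nat) (Om : set 'rV[R]_n) (eps : R)
    (A : set ('rV[R]_n -> R)) : \bar R :=
  ereal_inf [set (ln N%:R)%:E | N in [set N | covered_by Om eps A N]].

(* Main.v *)
(* On Omega a sup-norm ball of radius eps/2 lies in an L_2(nu)-ball of radius
   nu(Omega)^(1/2) eps/2 < delta^(1/2)/2.  Taking the first k = N_delta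
   coefficients (Bessel's inequality), a cover of the RKHS ball becomes a cover of
   the ellipsoid sum_(i<k) a_i^2/lam_i < 1 by N Euclidean balls of radius
   delta^(1/2)/2.  The ellipsoid contains a grid of mesh 2 (delta/k)^(1/2) with
   m_i = ceil((lam_i/delta)^(1/2)) >= 2 points in direction i, and each ball
   contains at most (7/5)^k <= 2^(k/2) grid points, by a Chernoff bound with
   Gaussian weights.  Hence N >= prod_i (m_i / sqrt 2) >= prod_i (lam_i/delta)^(1/4),
   that is ln N >= E(delta)/4, whatever the value of C. *)
Require Import Defs.
From HB Require Import structures.
From mathcomp Require Import all_boot all_order all_algebra.
From mathcomp Require Import all_classical all_reals all_analysis.
From mathcomp Require Import Rstruct Rstruct_topology.
From mathcomp Require Import measurable_realfun ring lra zify.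
Import Order.TTheory GRing.Theory Num.Theory.
Import numFieldNormedType.Exports.
Local Open Scope classical_set_scope.
Local Open Scope ring_scope.

(** * Lattice points in a Euclidean ball *)

Section LatticePoints.
Context {F : realType}.
Implicit Types x u d : F.

(* The rate makes gauss (j / 8) the rational (15/16)^(j^2), so that all numerical
   bounds reduce to rational arithmetic. *)
Definition gauss x : F := expR (- (64 * ln (16 / 15) * x ^+ 2)).

Lemma gauss_ge0 x : 0 <= gauss x.
Proof. exact: expR_ge0. Qed.

Lemma gaussN x : gauss (- x) = gauss x.
Proof. by rewrite /gauss sqrrN. Qed.

Lemma gauss_rate_ge0 : 0 <= 64 * ln (16 / 15) :> F.
Proof. by rewrite mulr_ge0// ln_ge0//; lra. Qed.

Lemma ler_gauss x y : 0 <= x -> x <= y -> gauss y <= gauss x.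
Proof.
move=> x0 xy; rewrite ler_expR lerN2 ler_wpM2l ?gauss_rate_ge0//.
by rewrite lerXn2r// nnegrE (le_trans x0).
Qed.

Lemma gauss_eighth (j : nat) : gauss (j%:R / 8) = (15 / 16) ^+ (j ^ 2).
Proof.
have -> : 15 / 16 = expR (- ln (16 / 15)) :> F.
  by rewrite -lnV ?posrE ?lnK ?posrE//; lra.
rewrite -expRM_natr /gauss; congr expR.
by rewrite natrX; field.
Qed.

Lemma gauss_shift x (j : nat) :
  0 <= x -> gauss (x + j%:R) <= gauss x * ((15 / 16) ^+ 64) ^+ j.
Proof.
move=> x0; rewrite -[64%N]/(8 ^ 2)%N -gauss_eighth divff ?pnatr_eq0//.
rewrite /gauss -expRM_natr -exp.expRD ler_expR.
have := gauss_rate_ge0; set c := 64 * _ => c0.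
have jj : j%:R <= j%:R ^+ 2 :> F by rewrite -natrX ler_nat -mulnn; nia.
have j0 : 0 <= j%:R :> F by [].
have : c * (x ^+ 2 + j%:R) <= c * (x + j%:R) ^+ 2.
  by rewrite ler_wpM2l// sqrrD; have := mulr_ge0 x0 j0; lra.
lra.
Qed.

(* (x + j)^2 >= x^2 + j dominates the sum by a geometric series of ratio gauss 1. *)
Lemma gauss_ray x (m : nat) :
  0 <= x -> \sum_(j < m) gauss (x + j%:R) <= gauss x * (51 / 50).
Proof.
move=> x0; set q : F := (15 / 16) ^+ 64.
have q0 : 0 < q by rewrite exprn_gt0//; lra.
have q1 : q <= 17 / 1000 by rewrite /q; lra.
apply: (@le_trans _ _ (\sum_(j < m) gauss x * q ^+ j)).
  by apply: ler_sum => j _; exact: gauss_shift.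
rewrite -mulr_sumr ler_wpM2l ?gauss_ge0//.
have H : (1 - q) * \sum_(j < m) q ^+ j <= 1.
  have <- : 1 - q ^+ m = (1 - q) * \sum_(j < m) q ^+ j.
    rewrite -[1 in LHS](expr1n _ m) subrXX; congr (_ * _).
    by apply: eq_bigr => i _; rewrite expr1n mul1r.
  by rewrite gerBl exprn_ge0// ltW.
have S0 : 0 <= \sum_(j < m) q ^+ j by rewrite sumr_ge0// => i _; rewrite exprn_ge0// ltW.
nra.
Qed.

(** By the symmetry between [d] and [1 - d], take [d <= 1/2]. On each interval from [i/8] to
    [(i+1)/8], monotonicity bounds the two terms by the rational values of [gauss] at [i/8] and
    [(7-i)/8]. *)
Lemma gauss_pair d : 0 <= d <= 1 -> gauss d + gauss (1 - d) <= 53 / 50.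
Proof.
wlog dh : d / d <= 1 / 2 => [H /andP[d0 d1]|/andP[d0 _]].
  have [/H|dh] := lerP d (1 / 2); first by apply; rewrite d0.
  by rewrite addrC; have := H (1 - d) ltac:(lra) ltac:(lra); rewrite subKr.
have bound (i j : nat) : i%:R / 8 <= d -> d <= 1 - j%:R / 8 ->
    gauss d + gauss (1 - d) <= (15 / 16) ^+ (i ^ 2) + (15 / 16) ^+ (j ^ 2).
  move=> id dj; rewrite -!gauss_eighth.
  by apply: lerD; apply: ler_gauss => //; lra.
have [h1|h1] := lerP d (1 / 8).
  by apply: (le_trans (bound 0%N 7%N _ _)); lra.
have [h2|h2] := lerP d (2 / 8).
  by apply: (le_trans (bound 1%N 6%N _ _)); lra.
have [h3|h3] := lerP d (3 / 8).
  by apply: (le_trans (bound 2%N 5%N _ _)); lra.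
by apply: (le_trans (bound 3%N 4%N _ _)); lra.
Qed.

(** For [u >= 0] the integers on either side of [u] form two rays starting at distances [d] and
    [1 - d] from it: [gauss_pair] controls the first terms, [gauss_ray] the tails. For [u < 0] one
    ray suffices. *)
Lemma gauss_sum u (m : nat) :
  \sum_(z < m) gauss (z%:R - u) <= 53 / 50 * (51 / 50).
Proof.
have [u0|u0] := ltrP u 0.
  under eq_bigr do rewrite addrC.
  apply: (le_trans (gauss_ray _ _ _)); first by lra.
  rewrite ler_pM2r; last by lra.
  have : gauss (- u) <= gauss 0 by apply: ler_gauss; lra.
  by rewrite {2}/gauss expr0n mulr0 oppr0 exp.expR0; lra.
have /andP[] := truncn_itv u0; set w := Num.truncn u => wu uw.
have leM : (m <= w.+1 + m)%N by rewrite leq_addl.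
(* Extra nonnegative terms keep the cut at [w.+1] inside the range even when [m <= w]. *)
apply: (@le_trans _ _ (\sum_(z < w.+1 + m) gauss (z%:R - u))).
  rewrite (big_ord_widen _ (fun z => gauss (z%:R - u)) leM).
  by rewrite [leRHS](bigID (fun z : 'I__ => (z < m)%N))/= lerDl sumr_ge0// => i _; exact: gauss_ge0.
rewrite big_split_ord/= (reindex_inj rev_ord_inj)/=.
have -> : \sum_(j < w.+1) gauss ((w.+1 - j.+1)%:R - u) =
          \sum_(j < w.+1) gauss ((u - w%:R) + j%:R).
  apply: eq_bigr => j _; rewrite -gaussN subSS natrB; last by have := ltn_ord j; lia.
  by congr gauss; ring.
have -> : \sum_(j < m) gauss ((w.+1 + j)%:R - u) =
          \sum_(j < m) gauss ((w.+1%:R - u) + j%:R).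
  by apply: eq_bigr => j _; rewrite natrD; congr gauss; ring.
have ray1 := gauss_ray (u - w%:R) w.+1 ltac:(lra).
have ray2 := gauss_ray (w.+1%:R - u) m ltac:(lra).
have := @gauss_pair (u - w%:R) ltac:(rewrite -natr1 in uw; lra).
have -> : 1 - (u - w%:R) = w.+1%:R - u by rewrite -natr1; ring.
lra.
Qed.

(** The weight [\prod_i (A * gauss _)] is at least 1 on the ball, and its sum over all [f] factors
    into [k] one-dimensional sums bounded by [gauss_sum]. *)
Lemma card_lattice_ball (k M : nat) (u : 'I_k -> F) :
  #|[pred f : {ffun 'I_k -> 'I_M} | \sum_i ((f i)%:R - u i) ^+ 2 <= k%:R / 16]|%:R
    <= (7 / 5) ^+ k :> F.
Proof.
(* A^k is the inverse of the weight exp(- 64 ln(16/15) k/16) on the boundary sphere. *)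
set B := [pred f | _]; set A : F := (16 / 15) ^+ 4.
have A0 : 0 <= A by rewrite exprn_ge0//; lra.
apply: (@le_trans _ _ (\sum_(f : {ffun 'I_k -> 'I_M}) \prod_i (A * gauss ((f i)%:R - u i)))).
  rewrite -sum1_card natr_sum [leRHS](bigID (mem B))/=.
  rewrite -[leLHS]addr0 lerD//; last first.
    by rewrite sumr_ge0// => f _; rewrite prodr_ge0// => i _; rewrite mulr_ge0// gauss_ge0.
  apply: ler_sum => f; rewrite inE => fB.
  rewrite big_split/= prodr_const card_ord /gauss -expR_sum sumrN -mulr_sumr.
  have -> : A = expR (4 * ln (16 / 15)) by rewrite expRM_natl lnK ?posrE//; lra.
  rewrite -expRM_natr -exp.expRD -[leLHS]exp.expR0 ler_expR.
  have l0 : 0 <= ln (16 / 15) :> F by apply: ln_ge0; lra.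
  by nra.
rewrite -(bigA_distr_bigA (fun i (z : 'I_M) => A * gauss (z%:R - u i))).
rewrite -[k in leRHS]card_ord -prodr_const; apply: ler_prod => i _.
rewrite -mulr_sumr mulr_ge0 ?sumr_ge0//=; last by move=> z _; exact: gauss_ge0.
have := gauss_sum (u i) M.
have : 0 <= \sum_(j < M) gauss (j%:R - u i) by rewrite sumr_ge0// => z _; exact: gauss_ge0.
(* Chosen because 1.2946 * (53/50) * (51/50) is just below 7/5. *)
have : A <= 12946 / 10000 by rewrite /A; lra.
by nra.
Qed.

End LatticePoints.

(** * Covering an ellipsoid by Euclidean balls *)

Section EllipsoidCovering.
Context {F : realType}.

(* m is the ceiling of sqrt r; the second bound combines m^2 >= r with m >= 2. *)
Lemma ex_grid_size (r : F) : 1 < r ->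
  exists2 m : nat, m.-1%:R ^+ 2 < r & 4 * r <= m%:R ^+ 4.
Proof.
move=> r1.
have : exists m : nat, r <= m%:R ^+ 2.
  exists (Num.truncn r).+1.
  have := truncnS_gt r; set y := _%:R => ry.
  have : y <= y ^+ 2 by rewrite expr2 ler_peMl//; lra.
  lra.
move=> /ex_minnP[m rm mmin].
have m2 : (2 <= m)%N by case: m rm {mmin} => [|[|//]]; rewrite ?expr0n/= ?expr1n; lra.
exists m; last first.
  have : 2 <= m%:R :> F by rewrite ler_nat.
  rewrite -[4%N]/(2 + 2)%N exprD => m2F.
  have : 4 <= m%:R ^+ 2 :> F by nra.
  by move: rm; set t := _ ^+ 2; nra.
rewrite ltNge; apply/negP => /mmin; lia.
Qed.

Lemma card_cover_ellipsoid {k N : nat} {lam : 'I_k -> F} {delta : F}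
    {b : 'I_N -> 'I_k -> F} :
  0 < delta -> (forall i, delta < lam i) ->
  (forall a : 'I_k -> F, \sum_i a i ^+ 2 / lam i < 1 ->
     exists j, \sum_i (a i - b j i) ^+ 2 <= delta / 4) ->
  \sum_i ln (lam i / delta) <= 4 * ln N%:R.
Proof.
move=> d0 dlam cover.
have lam0 i : 0 < lam i by apply: lt_trans (dlam i).
have [m mlt mge] : exists2 m : 'I_k -> nat,
    (forall i, (m i).-1%:R ^+ 2 < lam i / delta) &
    (forall i, 4 * (lam i / delta) <= (m i)%:R ^+ 4).
  have H i : {m : nat | (m.-1%:R ^+ 2 < lam i / delta) && (4 * (lam i / delta) <= m%:R ^+ 4)}.
    apply/cid; have [|m m1 m2] := @ex_grid_size (lam i / delta).
      by rewrite ltr_pdivlMr ?mul1r.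
    by exists m; rewrite m1 m2.
  by exists (fun i => sval (H i)) => i; have /andP[] := svalP (H i).
have m_gt0 i : (0 < m i)%N.
  have := mge i; case: (m i) => //; rewrite expr0n/= => h.
  by have := divr_gt0 (lam0 i) d0; lra.
(* All coordinates share the finite type ['I_M]; [G] then restricts coordinate [i] to its [m i]
   values. *)
pose M := (\max_i m i)%N.
pose G := family (fun i => [pred z : 'I_M | (z < m i)%N]).
(* For [k > 0], [k * s^2 = delta]: the squared coordinate [i] of a grid point is at most
   [s^2 * (m i - 1)^2 < lam i / k], and the squared radius [delta / 4] becomes [k / 16] in units of
   the mesh [2 * s]. *)
pose s : F := Num.sqrt (delta / k%:R).
pose a (f : {ffun 'I_k -> 'I_M}) i : F := s * (2 * (f i)%:R - (m i).-1%:R).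
(* u j is the center b j in grid coordinates. *)
pose u j i : F := b j i / (2 * s) + (m i).-1%:R / 2.
have cardG : #|G| = (\prod_i m i)%N.
  transitivity (\sum_(f in G) \prod_(i < k) 1)%N.
    by rewrite -sum1_card; apply: eq_bigr => f _; rewrite big1_eq.
  rewrite -(bigA_distr_big_dep (fun i => [pred z : 'I_M | (z < m i)%N]) (fun _ _ => 1%N)).
  apply: eq_bigr => i _; have mM : (m i <= M)%N by exact: leq_bigmax.
  by rewrite -[RHS]card_ord -sum1_card (big_ord_widen _ (fun=> 1%N) mM).
pose B j := [pred f : {ffun 'I_k -> 'I_M} | \sum_i ((f i)%:R - u j i) ^+ 2 <= k%:R / 16].
have GB f : f \in G -> exists j, f \in B j.
  (* For [k = 0] division by zero makes [s] vanish, but all sums are empty and [cover] still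
     supplies a ball. *)
  move=> /familyP fG; case: (posnP k) => [k0|k_gt0].
    have [|j _] := cover (a f).
      by rewrite big1// => i; have := ltn_ord i; rewrite {2}k0.
    exists j; rewrite inE big1; first by rewrite divr_ge0.
    by move=> i; have := ltn_ord i; rewrite {2}k0.
  have kF : 0 < k%:R :> F by rewrite ltr0n.
  have s0 : 0 < s by rewrite sqrtr_gt0 divr_gt0.
  have s2 : s ^+ 2 = delta / k%:R by rewrite sqr_sqrtr// divr_ge0// ltW.
  have [|j Hj] := cover (a f).
    have -> : 1 = \sum_(i < k) k%:R^-1 :> F.
      by rewrite sumr_const card_ord -[RHS]mulr_natr mulVf ?gt_eqF.
    apply: ltr_sum => [|i _]; first by apply/hasP; exists (Ordinal k_gt0); rewrite ?mem_index_enum.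
    rewrite ltr_pdivrMr// /a exprMn s2.
    have fi : (2 * (f i)%:R - (m i).-1%:R) ^+ 2 <= (m i).-1%:R ^+ 2 :> F.
      have : (f i)%:R <= (m i).-1%:R :> F.
        by rewrite ler_nat -ltnS prednK//; have := fG i; rewrite inE.
      have : 0 <= (f i)%:R :> F by [].
      by nra.
    have h : (2 * (f i)%:R - (m i).-1%:R) ^+ 2 < lam i / delta by apply: le_lt_trans (mlt i).
    rewrite ltr_pdivlMr// in h.
    have ki : 0 < k%:R^-1 :> F by rewrite invr_gt0.
    by nra.
  exists j; rewrite inE.
  have E : \sum_i (a f i - b j i) ^+ 2 = 4 * s ^+ 2 * \sum_i ((f i)%:R - u j i) ^+ 2.
    rewrite mulr_sumr; apply: eq_bigr => i _; rewrite /a /u.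
    by field; rewrite gt_eqF.
  move: Hj; rewrite E s2 => Hj.
  rewrite -(ler_pM2l (_ : 0 < 4 * (delta / k%:R))); last by rewrite mulr_gt0// divr_gt0.
  apply: (le_trans Hj); rewrite le_eqVlt; apply/orP; left; apply/eqP.
  by field; rewrite gt_eqF.
have cardGN : #|G|%:R <= N%:R * (7 / 5) ^+ k :> F.
  apply: (@le_trans _ _ (\sum_(j < N) #|B j|%:R)).
    rewrite -natr_sum ler_nat -sum1_card.
    (* Incidences between grid points and balls are counted in both orders. *)
    apply: (@leq_trans (\sum_(f in G) \sum_(j < N) (f \in B j))).
      apply: leq_sum => f /GB[j fj]; by rewrite (bigD1 j)//= fj.
    rewrite exchange_big/=; apply: leq_sum => j _.
    rewrite -sum1_card [leqRHS]big_mkcond/= big_mkcond/=.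
    by apply: leq_sum => f _; case: (f \in G); case: (f \in B j).
  have -> : N%:R * (7 / 5) ^+ k = \sum_(j < N) (7 / 5) ^+ k :> F.
    by rewrite sumr_const card_ord mulr_natl.
  by apply: ler_sum => j _; exact: card_lattice_ball.
(* Fourth powers avoid roots: [4 * (lam i / delta) <= m i ^ 4] and [(7/5)^4 <= 4], so the factors
   [4 ^+ k] cancel. *)
have key : \prod_i (lam i / delta) <= N%:R ^+ 4.
  have h4 : 4 ^+ k * \prod_i (lam i / delta) <= #|G|%:R ^+ 4.
    rewrite cardG natr_prod -prodrXl -[k in 4 ^+ k]card_ord -prodr_const -big_split/=.
    by apply: ler_prod => i _; rewrite mge andbT mulr_ge0// divr_ge0// ltW.
  have h5 : #|G|%:R ^+ 4 <= N%:R ^+ 4 * 4 ^+ k :> F.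
    apply: (@le_trans _ _ ((N%:R * (7 / 5) ^+ k) ^+ 4)).
      by rewrite lerXn2r ?nnegrE.
    rewrite exprMn ler_wpM2l ?exprn_ge0// exprAC lerXn2r ?nnegrE ?exprn_ge0//; lra.
  rewrite -(ler_pM2l (_ : 0 < 4 ^+ k)) ?exprn_gt0//.
  by rewrite [leRHS]mulrC (le_trans h4).
have p0 : 0 < \prod_i (lam i / delta) by rewrite prodr_gt0// => i _; rewrite divr_gt0.
(* [N = 0] would force the positive product to be at most 0; it is excluded before taking
   logarithms, as [ln 0] is only a default value. *)
have N0 : 0 < N%:R :> F.
  rewrite ltr0n lt0n; apply/eqP => N0; move: key; rewrite N0 expr0n/= => /(lt_le_trans p0).
  by rewrite ltxx.
have <- : ln (\prod_i (lam i / delta)) = \sum_i ln (lam i / delta).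
  rewrite -[RHS]expRK expR_sum; congr ln; apply: eq_bigr => i _.
  by rewrite lnK// posrE divr_gt0.
by rewrite mulr_natl -lnXn// ler_ln ?posrE// exprn_gt0.
Qed.
End EllipsoidCovering.

(** * Bounded measurable functions and Bessel's inequality *)

(** This class is stable under sums and products and, on a set of finite measure, consists of
    integrable functions, so it discharges every integrability condition below. *)
Definition bounded_mfun {F : realType} {d} {T : measurableType d} (D : set T) (f : T -> F) :=
  measurable_fun D f /\ exists M, forall x, D x -> `|f x| <= M.

Section BoundedMeasurable.
Context {F : realType} {d : measure_display} {T : measurableType d}.
Context {mu : {measure set T -> \bar F}} {D : set T}.
Implicit Types (f g h : T -> F) (c : F).

Lemma bounded_mfun_cst (c : F) : bounded_mfun D (cst c).
Proof. by split=> //; exists `|c|. Qed.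

Lemma bounded_mfunD f g :
  bounded_mfun D f -> bounded_mfun D g -> bounded_mfun D (fun x => f x + g x).
Proof.
move=> [mf [M fM]] [mg [M' gM]]; split; first exact: measurable_funD.
exists (M + M') => x Dx.
by rewrite (le_trans (ler_normD _ _))// lerD ?fM ?gM.
Qed.

Lemma bounded_mfunM f g :
  bounded_mfun D f -> bounded_mfun D g -> bounded_mfun D (fun x => f x * g x).
Proof.
move=> [mf [M fM]] [mg [M' gM]]; split; first exact: measurable_funM.
by exists (M * M') => x Dx; rewrite normrM ler_pM ?fM ?gM.
Qed.

Lemma bounded_mfunZ c f : bounded_mfun D f -> bounded_mfun D (fun x => c * f x).
Proof. by move=> bf; exact: (bounded_mfunM (cst c) f (bounded_mfun_cst c) bf). Qed.

Lemma bounded_mfunB f g :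
  bounded_mfun D f -> bounded_mfun D g -> bounded_mfun D (fun x => f x - g x).
Proof.
move=> bf /(bounded_mfunZ (-1)) /(bounded_mfunD _ _ bf).
by congr (bounded_mfun D _); apply/funext => x; rewrite mulN1r.
Qed.

Lemma bounded_mfun_sum k (f : nat -> T -> F) :
  (forall i, bounded_mfun D (f i)) -> bounded_mfun D (fun x => \sum_(i < k) f i x).
Proof.
move=> bf; elim: k => [|k IH].
  rewrite (_ : (fun _ => _) = cst 0); last by apply/funext => x; rewrite big_ord0.
  exact: bounded_mfun_cst.
under eq_fun do rewrite big_ord_recr/=.
exact: bounded_mfunD.
Qed.

Context (mD : measurable D) (muD : (mu D < +oo)%E).

Lemma integrable_bounded_mfun f : bounded_mfun D f -> mu.-integrable D (EFin \o f).
Proof.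
move=> [mf [M fM]]; apply: measurable_bounded_integrable => //.
exists M; split; first exact: num_real.
by move=> y My x Dx; rewrite /= (le_trans (fM _ Dx))// ltW.
Qed.

Lemma Rintegral_sum_bounded k (f : nat -> T -> F) :
  (forall i, bounded_mfun D (f i)) ->
  \int[mu]_(x in D) (\sum_(i < k) f i x) = \sum_(i < k) \int[mu]_(x in D) f i x.
Proof.
move=> bf; elim: k => [|k IH].
  rewrite big_ord0 (_ : (fun _ => _) = cst 0) ?Rintegral_cst ?mul0r//.
  by apply/funext => x; rewrite big_ord0.
rewrite big_ord_recr/= -IH -RintegralD//; [|exact/integrable_bounded_mfun/bounded_mfun_sum|exact: integrable_bounded_mfun].
by apply: eq_Rintegral => x _; rewrite big_ord_recr.
Qed.

Context (phi : nat -> T -> F) (bphi : forall i, bounded_mfun D (phi i)).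
Context (orthonormal :
  forall i j, \int[mu]_(x in D) (phi i x * phi j x) = (i == j)%:R).

Lemma orthonormal_coef k (a : nat -> F) (i : 'I_k) :
  \int[mu]_(x in D) ((\sum_(j < k) a j * phi j x) * phi i x) = a i.
Proof.
under eq_Rintegral do rewrite mulr_suml.
rewrite (@Rintegral_sum_bounded k (fun j x => a j * phi j x * phi i x)); last first.
  by move=> j; apply: bounded_mfunM => //; exact: bounded_mfunZ.
rewrite (bigD1 i)//= big1 ?addr0 => [|j ji]; under eq_Rintegral do rewrite -mulrA.
  by rewrite RintegralZl ?orthonormal ?eqxx ?mulr1//; apply/integrable_bounded_mfun/bounded_mfunM.
rewrite RintegralZl ?orthonormal//; last by apply/integrable_bounded_mfun/bounded_mfunM.
by move: ji; rewrite -val_eqE/= => /negbTE ->; rewrite mulr0.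
Qed.

(** Induction on [k] with [h] general: subtracting the projection [b * phi k] keeps the earlier
    coefficients and lowers the integral of the square by exactly [b ^+ 2]. *)
Lemma bessel k h : bounded_mfun D h ->
  \sum_(i < k) (\int[mu]_(x in D) (h x * phi i x)) ^+ 2 <= \int[mu]_(x in D) (h x ^+ 2).
Proof.
elim: k h => [|k IH] h bh.
  by rewrite big_ord0 Rintegral_ge0// => x _; exact: sqr_ge0.
set b := \int[mu]_(x in D) (h x * phi k x).
pose h' x := h x - b * phi k x.
have bh' : bounded_mfun D h' by apply: bounded_mfunB => //; exact: bounded_mfunZ.
have coefE (i : 'I_k) : \int[mu]_(x in D) (h' x * phi i x) = \int[mu]_(x in D) (h x * phi i x).
  under eq_Rintegral do rewrite mulrBl -mulrA.
  rewrite RintegralB//; first rewrite RintegralZl ?orthonormal ?gtn_eqF ?mulr0 ?subr0//.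
  - by apply/integrable_bounded_mfun/bounded_mfunM.
  - by apply/integrable_bounded_mfun/bounded_mfunM.
  - by apply/integrable_bounded_mfun/bounded_mfunZ/bounded_mfunM.
have sqE : \int[mu]_(x in D) (h' x ^+ 2) = \int[mu]_(x in D) (h x ^+ 2) - b ^+ 2.
  transitivity (\int[mu]_(x in D) (h x * h x - (2 * b * (h x * phi k x) - b ^+ 2 * (phi k x * phi k x)))).
    by apply: eq_Rintegral => x _; rewrite /h'; ring.
  have bhp : bounded_mfun D (fun x => h x * phi k x) by exact: bounded_mfunM.
  have bpp : bounded_mfun D (fun x => phi k x * phi k x) by exact: bounded_mfunM.
  rewrite RintegralB//; first last.
  - by apply/integrable_bounded_mfun/bounded_mfunB; exact: bounded_mfunZ.
  - by apply/integrable_bounded_mfun/bounded_mfunM.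
  rewrite RintegralB//; first last.
  - exact/integrable_bounded_mfun/bounded_mfunZ.
  - exact/integrable_bounded_mfun/bounded_mfunZ.
  rewrite !RintegralZl//; try exact: integrable_bounded_mfun.
  rewrite orthonormal eqxx /= -/b.
  under [in RHS]eq_Rintegral do rewrite expr2.
  by ring.
rewrite big_ord_recr/= -/b -lerBrDr -sqE.
by under eq_bigr do rewrite -coefE; exact: IH.
Qed.

End BoundedMeasurable.

(** * Borel measurability on a compact set, and finitely supported series *)

Section BorelContinuous.
Context {F : realType} {T : ptopologicalType} {D : set T}.
Notation BorelT := (g_sigma_algebraType (@open T)).

Lemma open_Borel (A : set T) : open A -> measurable (A : set BorelT).
Proof. exact: sub_sigma_algebra. Qed.

Lemma closed_Borel (A : set T) : closed A -> measurable (A : set BorelT).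
Proof. by move=> /closed_openC /open_Borel /measurableC; rewrite setCK. Qed.

Lemma within_continuous_measurable (f : T -> F) :
  measurable (D : set BorelT) -> {within D, continuous f} ->
  measurable_fun (D : set BorelT) (f : BorelT -> F).
Proof.
move=> mD /continuousP cf; apply: (measurability _ (RGenOpens.measurableE F)).
move=> _ [_ [a [b ->] <-]].
have /open_subspaceP[V oV VD] : open ((f : subspace D -> F) @^-1` `]a, b[%classic).
  exact/cf/interval_open.
by rewrite setIC -VD; apply: measurableI => //; exact: open_Borel.
Qed.

End BorelContinuous.

(** Turns both [Einf] and the series in [RKHS_ball] into finite sums. *)
Lemma cvg_series_finite_support {F : realType} (u : nat -> F) (k : nat) :
  (forall i, (k <= i)%N -> u i = 0) -> series u @ \oo --> \sum_(i < k) u i.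
Proof.
move=> u0; apply: cvg_near_cst; exists k => //= n kn.
rewrite /series/= (big_cat_nat (n := k))//= big_mkord.
rewrite [X in _ + X](_ : _ = 0) ?addr0// big_nat_cond big1// => i.
by rewrite andbT => /andP[/u0].
Qed.

Lemma compact_Borel {F : realType} {n : nat} {Om : set 'rV[F]_n} :
  compact Om -> measurable (Om : set (g_sigma_algebraType (@open 'rV[F]_n))).
Proof.
by move=> cOm; apply: closed_Borel; apply: compact_closed => //; exact: norm_hausdorff.
Qed.

Lemma bounded_mfun_continuous {F : realType} {n : nat} {Om : set 'rV[F]_n}
    (f : 'rV[F]_n -> F) :
  compact Om -> {within Om, continuous f} ->
  bounded_mfun (Om : set (g_sigma_algebraType (@open 'rV[F]_n))) f.
Proof.
move=> cOm cf; split.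
  by apply: within_continuous_measurable => //; exact: compact_Borel.
have /compact_bounded[M [_ fM]] := continuous_compact cf cOm.
by exists (M + 1) => x Omx; apply: (fM (M + 1)); [rewrite ltrDl|exists x].
Qed.

(** * From sup-norm balls to balls of coefficients *)

(** The bound [M] makes [sup] a genuine supremum rather than its default value on unbounded sets. *)
Lemma ler_supnorm_on {n : nat} {Om : set 'rV[R]_n} (g : 'rV[R]_n -> R) (M : R) x :
  (forall y, Om y -> `|g y| <= M) -> Om x -> `|g x| <= supnorm_on Om g.
Proof.
move=> gM Omx; apply: ub_le_sup; last by exists x.
by exists M => _ [y Omy <-]; exact: gM.
Qed.

(** Bessel's inequality for the difference [h]: its coefficients are those of the sum minus those of
    [c], and [h ^+ 2 <= r ^+ 2] on [Om]. *)
Lemma sum_sq_dist_coef_le {n : nat} {Om : set 'rV[R]_n}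
    {nu : {measure set (BorelRn n) -> \bar R}} {phi : nat -> 'rV[R]_n -> R}
    (k : nat) (a : nat -> R) (c : 'rV[R]_n -> R) (r : R) :
  compact Om -> (nu Om < +oo)%E ->
  (forall i, {within Om, continuous (phi i)}) ->
  (forall i j, \int[nu]_(x in Om) (phi i x * phi j x) = (i == j)%:R) ->
  {within Om, continuous c} ->
  supnorm_on Om (fun x => \sum_(i < k) a i * phi i x - c x) <= r ->
  \sum_(i < k) (a i - \int[nu]_(x in Om) (c x * phi i x)) ^+ 2 <= r ^+ 2 * fine (nu Om).
Proof.
move=> cOm nuOm cphi ortho cc sup_r.
have mOm := compact_Borel cOm.
have bphi i : bounded_mfun (Om : set (BorelRn n)) (phi i) by exact: bounded_mfun_continuous.
have bc : bounded_mfun (Om : set (BorelRn n)) c by exact: bounded_mfun_continuous.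
have bf : bounded_mfun (Om : set (BorelRn n)) (fun x => \sum_(i < k) a i * phi i x).
  by apply: (@bounded_mfun_sum _ _ (BorelRn n) Om k (fun i x => a i * phi i x)) => i; exact: bounded_mfunZ.
set h := (fun x => _ - c x) in sup_r.
have bh : bounded_mfun (Om : set (BorelRn n)) h by exact: bounded_mfunB.
have coefE (i : 'I_k) : \int[nu]_(x in Om) (h x * phi i x) =
    a i - \int[nu]_(x in Om) (c x * phi i x).
  under eq_Rintegral do rewrite mulrBl.
  rewrite RintegralB//; try by apply: integrable_bounded_mfun => //; exact: bounded_mfunM.
  by rewrite orthonormal_coef.
under eq_bigr do rewrite -coefE.
apply: (le_trans (bessel _ _ _ _ _ _ _ _)) => //.
rewrite -Rintegral_cst//; apply: le_Rintegral => //.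
- by apply: integrable_bounded_mfun => //; exact: bounded_mfunM.
- by apply: integrable_bounded_mfun => //; exact: bounded_mfun_cst.
have [M hM] := bh.2.
move=> x Omx; have hr := le_trans (ler_supnorm_on h M x hM Omx) sup_r.
by rewrite -real_normK ?num_real// lerXn2r// nnegrE (le_trans _ hr).
Qed.

(** * The entropy lower bound *)

Theorem theorem2 :
  exists C : R, 0 < C /\
  forall (n : nat) (Om : set 'rV[R]_n)
    (nu : {measure set (BorelRn n) -> \bar R})
    (K : 'rV[R]_n -> 'rV[R]_n -> R)
    (lam : nat -> R) (phi : nat -> 'rV[R]_n -> R)
    (eps dstar : R),
  (* Omega compact; nu a finite Borel measure carried by Omega *)
  compact Om ->
  (nu setT < +oo)%E ->
  nu (~` (Om : set (BorelRn n))) = 0%E ->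
  (* K continuous, symmetric, positive semidefinite on Omega *)
  {within Om `*` Om, continuous (fun p : 'rV[R]_n * 'rV[R]_n => K p.1 p.2)} ->
  (forall x y, Om x -> Om y -> K x y = K y x) ->
  (forall (m : nat) (xs : 'I_m -> 'rV[R]_n) (cs : 'I_m -> R),
      (forall i, Om (xs i)) ->
      0 <= \sum_(i < m) \sum_(j < m) cs i * cs j * K (xs i) (xs j)) ->
  (* continuous eigenfunctions forming an orthonormal basis of L_2(nu) *)
  (forall i, {within Om, continuous (phi i)}) ->
  (forall i j, (\int[nu]_(x in (Om : set (BorelRn n))) (phi i x * phi j x)%:E
                 = (if i == j then 1 else 0)%:E)%E) ->
  (forall g : 'rV[R]_n -> R, measurable_fun (Om : set (BorelRn n)) (g : BorelRn n -> (R : realType)) ->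
      (\int[nu]_(x in (Om : set (BorelRn n))) (g x ^+ 2)%:E < +oo)%E ->
      (forall i, (\int[nu]_(x in (Om : set (BorelRn n))) (g x * phi i x)%:E = 0)%E) ->
      {ae nu, forall x, Om x -> g x = 0}) ->
  (forall i, {ae nu, forall x, Om x ->
      (\int[nu]_(y in (Om : set (BorelRn n))) (K x y * phi i y)%:E = (lam i * phi i x)%:E)%E}) ->
  (* eigenvalues: lambda_1 >= lambda_2 >= ... > 0 *)
  (forall i, 0 < lam i) ->
  (forall i, lam i.+1 <= lam i) ->
  (* Mercer expansion, uniformly on Omega x Omega *)
  (forall e : R, 0 < e -> exists N0 : nat, forall N : nat, (N0 <= N)%N ->
      forall x y, Om x -> Om y ->
      `|K x y - \sum_(i < N) lam i * phi i x * phi i y| < e) ->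
  0 < eps ->
  (* dstar = min { delta | delta > nu(Omega) eps^2,
        N_delta >= lambda_1 exp(-E(delta)/(4C)) / (delta^(1/2) - nu(Omega)^(1/2) eps)^2 } *)
  (let admissible (d : R) :=
      fine (nu (Om : set (BorelRn n))) * eps ^+ 2 < d /\
      exists k : nat, Ndelta lam d k /\
        lam 0%N * expR (- (Einf d lam / (4 * C)))
          / (Num.sqrt d - Num.sqrt (fine (nu (Om : set (BorelRn n)))) * eps) ^+ 2 <= k%:R in
   admissible dstar /\ forall d, admissible d -> dstar <= d) ->
  (((4 : R)^-1 * Einf dstar lam)%:E <= Hext Om (eps / 2)%R (RKHS_ball Om lam phi))%E.
Proof.
(* The bound obtained does not depend on [C], so the witness 1 is arbitrary. *)
exists 1; split=> // n Om nu K lam phi eps dstar cOm nuT _ _ _ _ cphi ortho _ _.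
move=> lam0 lamS _ eps0 [[dstar_gt [k [[k_lt k_max] _]]] _].
set V := fine _ in dstar_gt.
have mOm := compact_Borel cOm.
have nuOm : (nu Om < +oo)%E by apply: le_lt_trans nuT; rewrite le_measure ?inE.
have V0 : 0 <= V by rewrite fine_ge0.
have d0 : 0 < dstar by apply: le_lt_trans dstar_gt; rewrite mulr_ge0// sqr_ge0.
have orthoR i j : \int[nu]_(x in Om) (phi i x * phi j x) = (i == j)%:R.
  by rewrite /Rintegral ortho; case: eqP.
(* Since [lam] is nonincreasing, the indices above the threshold are exactly the first [k]; with
   indices from 0, [k_max] is applied to [i.+1]. *)
have lamE i : (dstar < lam i) = (i < k)%N.
  apply/idP/idP => [dlam|ik]; first exact: k_max.
  case: k_lt => [k0|[k0 /lt_le_trans]]; first by rewrite k0 in ik.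
  by apply; apply: (homo_leq (r := fun x y => y <= x)) => // [y x z xy yz|]; [exact: le_trans xy|lia].
have -> : Einf dstar lam = \sum_(i < k) ln (lam i / dstar).
  pose v i := if dstar < lam i then ln (lam i / dstar) else 0.
  have v0 i : (k <= i)%N -> v i = 0 by move=> ki; rewrite /v lamE ltnNge ki.
  rewrite /Einf (cvg_lim _ (cvg_series_finite_support v k v0))//.
  by apply: eq_bigr => i _; rewrite /v lamE ltn_ord.
apply: le_ereal_inf_tmp => _ [N [c [cc cover]] <-]; rewrite lee_fin.
suff : \sum_(i < k) ln (lam i / dstar) <= 4 * ln N%:R by lra.
(* Each centre [c j] is replaced by the vector of its first [k] coefficients in the orthonormal
   system. *)
apply: (@card_cover_ellipsoid _ _ _ (fun i => lam i) _
  (fun j i => \int[nu]_(x in Om) (c j x * phi i x))) => // [i|a a1].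
  by rewrite lamE.
(* Extension by zero makes a point of the ellipsoid a coefficient sequence of an element of
   [RKHS_ball]. *)
pose a' i := if insub i is Some i' then a i' else 0.
have a'E (i : 'I_k) : a' i = a i by rewrite /a' valK.
have a'0 i : (k <= i)%N -> a' i = 0 by move=> ki; rewrite /a' insubF// ltnNge ki.
have [|j fcj] := cover (fun x => \sum_(i < k) a' i * phi i x).
  have cvg_norm : series (fun i => a' i ^+ 2 / lam i) @ \oo --> \sum_(i < k) a' i ^+ 2 / lam i.
    by apply: cvg_series_finite_support => i /a'0 ->; rewrite expr0n mul0r.
  exists a'; split; first by apply/cvg_ex; eexists; exact: cvg_norm.
  split.
    rewrite (cvg_lim _ cvg_norm)//.
    by under eq_bigr do rewrite a'E.
  move=> x _; apply: (cvg_series_finite_support (fun i => a' i * phi i x)).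
  by move=> i /a'0 ->; rewrite mul0r.
exists j; under eq_bigr do rewrite -a'E.
apply: (le_trans (sum_sq_dist_coef_le _ _ _ (eps / 2) _ _ _ _ _ _)) => //.
  exact: ltW.
(* [(eps / 2)^2 * V = V * eps^2 / 4 < dstar / 4], by [dstar_gt]. *)
by rewrite -/V; lra.
Qed.
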